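(* In $\mathrm{fGC}_0^{\ge 2}$ it holds that $D^2=0$.
   Context: Let $\mathbb K$ be a field of characteristic zero. $\mathrm{fGC}_0^{\ge i}$ is the space of formal, possibly infinite, $\mathbb K$-linear combinations of isomorphism classes of finite, not necessarily connected graphs with $v\ge1$ vertices and $e\ge 0$ edges, without tadpoles (edges from a vertex to itself), all vertices at least $i$-valent, equipped with an ordering of the edges, modulo the relation that permuting the ordering multiplies by the sign of the permutation (vertices are unordered and edges undirected, so graphs with a multiple edge are zero). Deleting a vertex: $D(\Gamma)=\sum_{x\in V(\Gamma)}(-1)^{v(x)}\tilde D_x(\Gamma)$, where $v(x)$ is the valence of $x$ and $\tilde D_x$ deletes the vertex $x$ and sums over all ways of reconnecting the edge-ends that were at $x$ to the other vertices, skipping graphs with a tadpole; the edges keep their order. Graphs with no vertices are regarded as zero. $D$ maps $\mathrm{fGC}_0^{\ge i}$ to itself for $i\in\{1,2\}$. *)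

(* Defs.v *)
From HB Require Import structures.
From mathcomp Require Import all_boot all_order perm all_algebra.
From mathcomp Require Import boolp functions.

Set Implicit Arguments.
Unset Strict Implicit.
Unset Printing Implicit Defensive.

Import GRing.Theory.
Local Open Scope ring_scope.
Local Open Scope quotient_scope.

(* A multigraph on the vertices 'I_n with ordered edges is the family of its  *)
(* e edges, each given by its set of end points.  Edge j is a tadpole iff     *)
(* #|G j| = 1.                                                                *)
Definition edge_family (n e : nat) := {ffun 'I_e -> {set 'I_n}}.

Section EdgeFamily.
Variables n e : nat.
Implicit Types (G H : edge_family n e) (x : 'I_n).

Definition edges_at G x : {set 'I_e} := [set j | x \in G j].
Definition valence G x : nat := #|edges_at G x|.
Definition loopless G : bool := [forall j, #|G j| == 2%N].
Definition min_valence (i : nat) G : bool := [forall x, (i <= valence G x)%N].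

(* `s` and `t` carry G to H, `t` being the effect on the order of the edges.  *)
Definition carries (s : 'S_n) (t : 'S_e) G H : bool :=
  [forall j, H (t j) == s @: G j].

Lemma carries_valence s t G H x :
  carries s t G H -> valence H (s x) = valence G x.
Proof.
move=> /forallP GH; rewrite /valence -[RHS](card_imset _ (@perm_inj _ t)).
apply: eq_card => j; rewrite -[j](permKV t) (mem_imset _ _ (@perm_inj _ t)).
by rewrite !inE (eqP (GH _)) (mem_imset _ _ (@perm_inj _ s)).
Qed.

Lemma carries_loopless s t G H : carries s t G H -> loopless H = loopless G.
Proof.
move=> /forallP GH; apply/forallP/forallP => lG j.
  by have := lG (t j); rewrite (eqP (GH j)) (card_imset _ (@perm_inj _ s)).
by rewrite -[j](permKV t) (eqP (GH _)) (card_imset _ (@perm_inj _ s)).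
Qed.

End EdgeFamily.

Record graph (i n e : nat) := Graph {
  graph_edges :> edge_family n e;
  _ : loopless graph_edges && min_valence i graph_edges
}.
HB.instance Definition _ i n e := [isSub for @graph_edges i n e].
HB.instance Definition _ i n e := [Countable of graph i n e by <:].
HB.instance Definition _ i n e := [Finite of graph i n e by <:].

Lemma graph_loopless i n e (G : graph i n e) : loopless G.
Proof. by case: G => /= G /andP[]. Qed.

Lemma graph_min_valence i n e (G : graph i n e) : min_valence i G.
Proof. by case: G => /= G /andP[]. Qed.

Section Deletion.
Variables n e : nat.
Implicit Types (G : edge_family n.+1 e) (x : 'I_n.+1).

(* A way of reconnecting the edge-ends at x: r j is the vertex other than x   *)
(* receiving the end at x of the edge j; r j is set to x if j is not at x.    *)
Definition reconnections G x : {pred {ffun 'I_e -> 'I_n.+1}} :=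
  [pred r | r \in pffun_on x (mem (edges_at G x)) (predC1 x)].

(* `lift x` numbers the vertices other than x by 'I_n.  A reconnected edge    *)
(* r j |: (G j :\ x) has a single end point iff it has become a tadpole.      *)
Definition delete G x (r : {ffun 'I_e -> 'I_n.+1}) : edge_family n e :=
  [ffun j => lift x @^-1: (if x \in G j then r j |: (G j :\ x) else G j)].

End Deletion.

Section DeletionTheory.
Variables n e : nat.
Implicit Types (G H : edge_family n.+1 e) (x : 'I_n.+1).

Lemma reconnectionsP G x (r : {ffun 'I_e -> 'I_n.+1}) :
  reflect (forall j, (r j == x) = (x \notin G j)) (r \in reconnections G x).
Proof.
rewrite inE; apply: (iffP pffun_onP) => [[/subsetP sr rx] j|rx].
  apply/idP/idP => [/eqP rj|]; last first.
    by apply: contraR => rj; have := sr j; rewrite !inE rj; apply.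
  apply/negP => jx; have : r j \in predC1 x.
    by apply: rx; apply/imageP; exists j; rewrite ?inE.
  by rewrite !inE rj eqxx.
split; first by apply/subsetP => j; rewrite !inE rx negbK.
by move=> _ /imageP[j jx ->]; rewrite !inE in jx *; rewrite rx jx.
Qed.

Lemma valence_delete G x r k :
  (valence G (lift x k) <= valence (delete G x r) k)%N.
Proof.
apply/subset_leq_card/subsetP => j; rewrite !inE ffunE inE; case: ifP => //.
by rewrite !inE [lift x k == x]eq_sym neq_lift /= => _ ->; rewrite orbT.
Qed.

Lemma min_valence_delete i G x r :
  min_valence i G -> min_valence i (delete G x r).
Proof.
move=> /forallP iG; apply/forallP => k.
exact: leq_trans (iG (lift x k)) (valence_delete G x r k).
Qed.

(* The renumbering of the vertices other than x and s x induced by s.         *)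
Lemma lift_perm_exists (s : 'S_n.+1) x :
  {s' : 'S_n | forall k, lift (s x) (s' k) = s (lift x k)}.
Proof.
have sxk k : s x != s (lift x k) by rewrite (inj_eq perm_inj) neq_lift.
pose f k := s2val (unlift_some (sxk k)).
have fE k : lift (s x) (f k) = s (lift x k).
  by rewrite /f; case: (unlift_some (sxk k)).
have f_inj : injective f.
  by move=> k l fkl; apply/(@lift_inj _ x)/(@perm_inj _ s); rewrite -!fE fkl.
by exists (perm f_inj) => k; rewrite permE.
Qed.

Lemma carries_delete s (s' : 'S_n) t G H x (r : {ffun 'I_e -> 'I_n.+1}) :
  carries s t G H -> (forall k, lift (s x) (s' k) = s (lift x k)) ->
  carries s' t (delete G x r) (delete H (s x) [ffun j => s (r ((t^-1)%g j))]).
Proof.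
move=> /forallP GH s'E; apply/forallP => j; apply/eqP/setP => k.
rewrite -[k](permKV s') (mem_imset _ _ (@perm_inj _ s')) !ffunE permK !inE.
rewrite s'E (eqP (GH j)) (mem_imset _ _ (@perm_inj _ s)).
set l := (s'^-1)%g k; case: ifP => _; last first.
  by rewrite (mem_imset _ _ (@perm_inj _ s)).
by rewrite !inE !(inj_eq perm_inj) (mem_imset _ _ (@perm_inj _ s)).
Qed.

Lemma carries_reconnections s t G H x (r : {ffun 'I_e -> 'I_n.+1}) :
  carries s t G H ->
  ([ffun j => s (r ((t^-1)%g j))] \in reconnections H (s x)) =
  (r \in reconnections G x).
Proof.
move=> /forallP GH; apply/reconnectionsP/reconnectionsP => rG j.
  have := rG (t j); rewrite ffunE permK (inj_eq perm_inj) (eqP (GH j)).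
  by rewrite (mem_imset _ _ (@perm_inj _ s)).
rewrite ffunE (inj_eq perm_inj) rG -{2}[j](permKV t) (eqP (GH _)).
by rewrite (mem_imset _ _ (@perm_inj _ s)).
Qed.

Lemma delete_graphP i (G : graph i n.+1 e) x r : loopless (delete G x r) ->
  loopless (delete G x r) && min_valence i (delete G x r).
Proof. by move=> lG; rewrite lG min_valence_delete ?graph_min_valence. Qed.

End DeletionTheory.

Section GraphComplex.
Variables (K : fieldType) (i : nat).

Section Homogeneous.
Variables n e : nat.

(* The basis vector of G; it is 0 if G is not the edge family of a graph, but *)
(* by `delete_graphP` this does not occur in `Dgraph` below.                  *)
Definition gvec (G : edge_family n e) : {ffun graph i n e -> K^o} :=
  [ffun H : graph i n e => (graph_edges H == G)%:R].

(* Renumbering the vertices by s identifies isomorphic graphs, permuting the  *)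
(* edges by t multiplies by the sign of t.                                    *)
Definition relations : {vspace {ffun graph i n e -> K^o}} :=
  (\sum_(G : graph i n e) \sum_(H : graph i n e)
     \sum_(s : 'S_n) \sum_(t : 'S_e | carries s t G H)
       <[ gvec H - (-1) ^+ t *: gvec G ]>)%VS.

End Homogeneous.

Definition Dgraph n e (G : edge_family n.+1 e) : {ffun graph i n e -> K^o} :=
  \sum_(x : 'I_n.+1) (-1) ^+ valence G x *:
    \sum_(r in reconnections G x | loopless (delete G x r)) gvec (delete G x r).

(* Formal, possibly infinite, linear combinations of graphs with p.1 + 1      *)
(* vertices and p.2 edges, p ranging over nat * nat.                          *)
Definition formal_sum := {p : nat * nat & graph i p.1.+1 p.2} -> K^o.
HB.instance Definition _ := GRing.Lmodule.on formal_sum.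

Definition component n e (c : formal_sum) : {ffun graph i n.+1 e -> K^o} :=
  [ffun G : graph i n.+1 e =>
     c (Tagged (fun p : nat * nat => graph i p.1.+1 p.2) (i := (n, e)) G)].

(* There are finitely many graphs with given numbers of vertices and edges,   *)
(* and the relations preserve these numbers: an infinite combination of       *)
(* relations is one with components in the spans `relations`.                 *)
Definition fgc_rel : {pred formal_sum} :=
  [pred c | `[< forall n e, component n e c \in relations n.+1 e >]].

Lemma component_is_linear n e : linear (component n e).
Proof. by move=> a c d; apply/ffunP => G; rewrite !ffunE. Qed.

HB.instance Definition _ n e :=
  GRing.isLinear.Build K formal_sum {ffun graph i n.+1 e -> K^o} _
    (component n e) (component_is_linear n e).

Lemma fgc_relP c :
  reflect (forall n e, component n e c \in relations n.+1 e) (c \in fgc_rel).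
Proof. by rewrite inE; apply: asboolP. Qed.

Fact fgc_rel_closed : submod_closed fgc_rel.
Proof.
split=> [|a c d /fgc_relP cR /fgc_relP dR]; apply/fgc_relP => n e.
  by rewrite raddf0 mem0v.
by rewrite linearP memvD ?memvZ ?cR ?dR.
Qed.

HB.instance Definition _ :=
  GRing.isSubmodClosed.Build K formal_sum fgc_rel fgc_rel_closed.

Definition fGC := Quotient.quot fgc_rel.
HB.instance Definition _ := GRing.Zmodule.on fGC.
HB.instance Definition _ := Quotient.on fGC.

Lemma fGC_eqP (c d : formal_sum) :
  reflect (\pi_fGC c = \pi_fGC d) (c - d \in fgc_rel).
Proof. by rewrite (Quotient.idealrBE fgc_rel); apply: eqP. Qed.

Fact pi_fGC_is_zmod_morphism : {morph \pi_fGC : c d / c - d}.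
Proof. exact: (@raddfB _ _ (\pi_(Quotient.quot fgc_rel))). Qed.

Fact pi_fGCD : {morph \pi_fGC : c d / c + d}.
Proof. exact: (@raddfD _ _ (\pi_(Quotient.quot fgc_rel))). Qed.

Definition fGC_scale (a : K) (x : fGC) : fGC := \pi_fGC (a *: repr x).

Fact pi_fGC_scale a c : fGC_scale a (\pi_fGC c) = \pi_fGC (a *: c).
Proof. by apply/fGC_eqP; rewrite -scalerBr rpredZ//; apply/fGC_eqP; rewrite reprK. Qed.

Fact fGC_scaleA a b x : fGC_scale a (fGC_scale b x) = fGC_scale (a * b) x.
Proof. by rewrite -[x]reprK (pi_fGC_scale b) !pi_fGC_scale scalerA. Qed.

Fact fGC_scale1 : left_id 1 fGC_scale.
Proof. by move=> x; rewrite -[x]reprK pi_fGC_scale scale1r. Qed.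

Fact fGC_scaleDr : right_distributive fGC_scale +%R.
Proof.
move=> a x y; rewrite -[x]reprK -[y]reprK -pi_fGCD !pi_fGC_scale.
by rewrite -pi_fGCD scalerDr.
Qed.

Fact fGC_scaleDl x : {morph fGC_scale^~ x : a b / a + b}.
Proof.
by move=> a b; rewrite -[x]reprK !pi_fGC_scale -pi_fGCD scalerDl.
Qed.

HB.instance Definition _ := GRing.Zmodule_isLmodule.Build K fGC
  fGC_scaleA fGC_scale1 fGC_scaleDr fGC_scaleDl.

Fact pi_fGC_is_linear : linear (\pi_fGC : formal_sum -> fGC).
Proof. by move=> a c d; rewrite pi_fGCD -pi_fGC_scale. Qed.

HB.instance Definition _ :=
  GRing.isLinear.Build K formal_sum fGC _ \pi_fGC pi_fGC_is_linear.

Definition Dhom n e (f : {ffun graph i n.+1 e -> K^o}) :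
    {ffun graph i n e -> K^o} :=
  \sum_(G : graph i n.+1 e) (f G : K) *: Dgraph G.

(* The coefficients of graphs with n + 1 vertices only involve those of       *)
(* graphs with n + 2 vertices.  One-vertex graphs are sent to 0.              *)
Definition Dsum (c : formal_sum) : formal_sum :=
  fun G => Dhom (component (tag G).1.+1 (tag G).2 c) (tagged G).

Definition D (x : fGC) : fGC := \pi_fGC (Dsum (repr x)).

Lemma component_Dsum n e c : component n e (Dsum c) = Dhom (component n.+1 e c).
Proof. by apply/ffunP => G; rewrite ffunE. Qed.

Lemma Dhom_is_linear n e : linear (@Dhom n e).
Proof.
move=> a f g; rewrite /Dhom scaler_sumr -big_split /=.
by apply: eq_bigr => G _; rewrite !ffunE scalerDl scalerA.
Qed.

HB.instance Definition _ n e :=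
  GRing.isLinear.Build K {ffun graph i n.+1 e -> K^o} {ffun graph i n e -> K^o}
    _ (@Dhom n e) (@Dhom_is_linear n e).

Lemma Dsum_is_linear : linear Dsum.
Proof.
move=> a c d; apply/funext => G.
by rewrite /Dsum linearP linearP !ffunE.
Qed.

HB.instance Definition _ :=
  GRing.isLinear.Build K formal_sum formal_sum _ Dsum Dsum_is_linear.

Lemma Dhom_gvec n e (G : graph i n.+1 e) : Dhom (gvec G) = Dgraph G.
Proof.
rewrite /Dhom (bigD1 G)//= big1 ?addr0 => [|H HG].
  by rewrite ffunE eqxx scale1r.
by rewrite ffunE (inj_eq val_inj) (negPf HG) scale0r.
Qed.

Lemma relation_mem n e s t (G H : graph i n e) : carries s t G H ->
  gvec H - (-1) ^+ t *: gvec G \in relations n e.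
Proof.
move=> GH; apply: (subvP _ _ (memv_line _)).
rewrite /relations (bigD1 G)//= (bigD1 H)//= (bigD1 s)//= (bigD1 t)//=.
by do 3![apply: subv_trans (addvSl _ _)]; apply: addvSl.
Qed.

Lemma relations_sub n e (U : {vspace {ffun graph i n e -> K^o}}) :
  (forall s t (G H : graph i n e), carries s t G H ->
     gvec H - (-1) ^+ t *: gvec G \in U) -> (relations n e <= U)%VS.
Proof.
move=> rU; apply/subv_sumP => G _; apply/subv_sumP => H _.
by apply/subv_sumP => s _; apply/subv_sumP => t /rU; rewrite memvE.
Qed.

Lemma Dgraph_relation n e s t (G H : graph i n.+1 e) : carries s t G H ->
  Dgraph H - (-1) ^+ t *: Dgraph G \in relations n e.
Proof.
move=> GH; rewrite /Dgraph (reindex_inj (@perm_inj _ s)) /= scaler_sumr -sumrB.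
apply: rpred_sum => x _; rewrite (carries_valence _ GH).
rewrite [(-1) ^+ t *: _]scalerA mulrC -scalerA -scalerBr memvZ//.
pose h (r : {ffun 'I_e -> 'I_n.+1}) := [ffun j => s (r ((t^-1)%g j))].
have h_bij : bijective h.
  exists (fun r : {ffun 'I_e -> 'I_n.+1} => [ffun j => (s^-1)%g (r (t j))]) => r.
    by apply/ffunP => j; rewrite !ffunE !permK.
  by apply/ffunP => j; rewrite !ffunE !permKV.
have [s' s'E] := lift_perm_exists s x.
rewrite (reindex h) /=; last exact: onW_bij.
under eq_bigl => r do
  rewrite (carries_reconnections _ _ GH) (carries_loopless (carries_delete r GH s'E)).
rewrite scaler_sumr -sumrB; apply: rpred_sum => r /andP[_ lG].
have lH : loopless (delete H (s x) (h r)).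
  by rewrite (carries_loopless (carries_delete r GH s'E)).
apply: (@relation_mem _ _ s' t (Graph (delete_graphP lG)) (Graph (delete_graphP lH))).
exact: carries_delete r GH s'E.
Qed.

Lemma Dhom_relations n e f : f \in relations n.+1 e -> Dhom f \in relations n e.
Proof.
move=> fR; rewrite -(lfunE (@Dhom n e)) memv_preim; apply: (subvP _ _ fR).
apply: relations_sub => s t G H GH; rewrite -memv_preim lfunE /=.
by rewrite linearB linearZ /= !Dhom_gvec; apply: Dgraph_relation GH.
Qed.

Lemma Dsum_rel c : c \in fgc_rel -> Dsum c \in fgc_rel.
Proof.
move=> /fgc_relP cR; apply/fgc_relP => n e.
by rewrite component_Dsum Dhom_relations ?cR.
Qed.

Lemma D_pi c : D (\pi_fGC c) = \pi_fGC (Dsum c).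
Proof.
by apply/fGC_eqP; rewrite -linearB Dsum_rel//; apply/fGC_eqP; rewrite reprK.
Qed.

Fact D_is_linear : linear D.
Proof.
move=> a x y; rewrite -[x]reprK -[y]reprK -linearP !D_pi.
by rewrite linearP [LHS]linearP.
Qed.

HB.instance Definition _ := GRing.isLinear.Build K fGC fGC _ D D_is_linear.

End GraphComplex.

(* Main.v *)
Require Import Defs.
From mathcomp Require Import all_boot all_order perm all_algebra.

Set Implicit Arguments.
Unset Strict Implicit.
Unset Printing Implicit Defensive.

Import GRing.Theory.
Local Open Scope ring_scope.

(** [D^2] of a graph is a sum over ordered pairs of distinct vertices [(x, y)],
[x] being deleted first.  Suppose that some edge [j] joins [x] to a vertex [u]
other than [y].  Its end at [x] reaches its final place [w] in two ways: by
going to [w] when [x] is deleted, or by going to [y] and moving on to [w] when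
[y] is deleted.  The resulting graph is the same, but the valence that [y] has
when it is deleted differs by one, so the two contributions have opposite signs.
Exchanging the two ways is thus a sign-reversing involution of the terms indexed
by [(x, y)], and their sum is zero ([sum_delete2_eq0]).

If there is no such [j], all edges at [x] join it to [y]; there are at least two
of them because [x] is at least bivalent ([edge_avoiding]).  Exchanging the
order of two parallel edges is an odd symmetry, so the graph is zero modulo the
relations ([multiple_edge_relation]), and [D^2] preserves these.

With [r] and [q] the reconnections for [x] and [y], the involution simply
exchanges the values of [r] and [q] at [j]: vertex [y] is also the value of [q]
at an edge which is not at [y], so that going directly to [w] is encoded by
[(w, y)], and going there through [y] by [(y, w)]. *)

(** * Sign-reversing involutions *)

Lemma sum_sign_reversing (K : fieldType) (V : lmodType K) (I : finType)
    (P : pred I) (F : I -> V) (h : I -> I) :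
  (2 : K) != 0 ->
  (forall p, P p -> P (h p)) -> (forall p, P p -> h (h p) = p) ->
  (forall p, P p -> F (h p) = - F p) ->
  \sum_(p | P p) F p = 0.
Proof.
move=> two_neq0 Ph hK Fh; set S := \sum_(p | P p) F p.
have SN : S = - S.
  rewrite {1}/S (reindex_onto h h) // -sumrN; apply: eq_big => p.
    apply/andP/idP => [[Php /eqP <-]|Pp]; first exact: Ph.
    by rewrite Ph // hK.
  by move=> /andP[Php /eqP hhp]; apply: Fh; rewrite -hhp Ph.
have : (2 : K) *: S = 0 by rewrite scaler_nat mulr2n {1}SN addNr.
by move/eqP; rewrite scaler_eq0 (negPf two_neq0) => /eqP.
Qed.

(** * Deleting two vertices *)

Lemma in_delete n e (G : edge_family n.+1 e) x r j k :
  r \in reconnections G x ->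
  (k \in delete G x r j) = (lift x k \in G j) || (r j == lift x k).
Proof.
move=> /reconnectionsP/(_ j) rj; rewrite ffunE inE.
have kx : (lift x k == x) = false by rewrite eq_sym (negPf (neq_lift _ _)).
case: ifPn => xj; first by rewrite !inE kx eq_sym orbC.
by move: rj; rewrite xj => /eqP ->; rewrite eq_sym kx orbF.
Qed.

Section DeleteTwice.
Variables n e : nat.
Implicit Types (G : edge_family n.+2 e) (x : 'I_n.+2) (y k : 'I_n.+1).
Implicit Types (r : {ffun 'I_e -> 'I_n.+2}) (q : {ffun 'I_e -> 'I_n.+1}).

Definition admissible G x y (p : {ffun 'I_e -> 'I_n.+2} * {ffun 'I_e -> 'I_n.+1})
    : bool :=
  [&& p.1 \in reconnections G x, loopless (delete G x p.1),
      p.2 \in reconnections (delete G x p.1) y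
    & loopless (delete (delete G x p.1) y p.2)].

(** The values of the two reconnections are numbered differently: [lift x] and
[unlift x] translate between them, and are inverse to each other on admissible
pairs, for which [p.1 j] is not [x] when [j] is an edge at [x]. *)
Definition exchange x y (j : 'I_e)
    (p : {ffun 'I_e -> 'I_n.+2} * {ffun 'I_e -> 'I_n.+1}) :=
  ([ffun l => if l == j then lift x (p.2 j) else p.1 l],
   [ffun l => if l == j then odflt y (unlift x (p.1 j)) else p.2 l]).

Section Exchange.
Variables (G : edge_family n.+2 e) (x : 'I_n.+2) (y : 'I_n.+1) (j : 'I_e).
Hypotheses (lG : loopless G) (xj : x \in G j) (yj : lift x y \notin G j).
Variables (r : {ffun 'I_e -> 'I_n.+2}) (q : {ffun 'I_e -> 'I_n.+1}).
Hypothesis Prq : admissible G x y (r, q).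

Let r' := (exchange x y j (r, q)).1.
Let q' := (exchange x y j (r, q)).2.

Let rG : r \in reconnections G x. Proof. by case/and4P: Prq. Qed.
Let qG : q \in reconnections (delete G x r) y. Proof. by case/and4P: Prq. Qed.

Lemma lift_exchange : r j = lift x (q' j).
Proof.
have := reconnectionsP _ _ _ rG j; rewrite xj /q' !ffunE eqxx /=.
by case: unliftP => [k -> //|->]; rewrite eqxx.
Qed.

Lemma exchange_reconnections1 : r' \in reconnections G x.
Proof.
apply/reconnectionsP => l; rewrite ffunE; have [->|_] := eqVneq l j.
  by rewrite xj eq_sym (negPf (neq_lift _ _)).
exact: reconnectionsP.
Qed.

Lemma delete_exchange1 l : l != j -> delete G x r' l = delete G x r l.
Proof. by move=> lj; rewrite !ffunE (negPf lj). Qed.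

Lemma in_delete_pivot : (y \in delete G x r j) = (q' j == y).
Proof.
rewrite in_delete // (negPf yj) lift_exchange.
by rewrite (inj_eq (@lift_inj _ x)).
Qed.

Lemma in_delete_pivot_exchange : (y \in delete G x r' j) = (q j == y).
Proof.
rewrite in_delete ?exchange_reconnections1 // (negPf yj) ffunE eqxx /=.
by rewrite (inj_eq (@lift_inj _ x)).
Qed.

(** [q j] is [y] when [j] goes directly to its final place, and [q' j], which is
[r j] renumbered, is [y] when [j] goes there through [y]. *)
Lemma exchange_pivot : (q j == y) = (q' j != y).
Proof. by rewrite (reconnectionsP _ _ _ qG j) in_delete_pivot. Qed.

Lemma exchange_reconnections2 : q' \in reconnections (delete G x r') y.
Proof.
apply/reconnectionsP => l; have [->|lj] := eqVneq l j.
  by rewrite in_delete_pivot_exchange exchange_pivot negbK.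
rewrite delete_exchange1 // ffunE (negPf lj).
exact: reconnectionsP.
Qed.

Lemma delete2_exchange :
  delete (delete G x r') y q' = delete (delete G x r) y q.
Proof.
apply/ffunP => l; apply/setP => k.
rewrite !in_delete ?exchange_reconnections1 ?exchange_reconnections2 //.
have [->|lj] := eqVneq l j; last by rewrite !ffunE (negPf lj).
rewrite lift_exchange [r' j]ffunE eqxx /= !(inj_eq (@lift_inj _ x)).
by rewrite -!orbA [(q j == _) || _]orbC.
Qed.

(** A tadpole at [j] after reconnecting by [r'] would mean that [q j] is the other
end [u] of [j].  As [u] is not [y], for the pair [(r, q)] the edge [j] then
passes through [y] and returns to [u], so that it is a tadpole in the final
graph. *)
Lemma exchange_loopless : loopless (delete G x r').
Proof.
case/and4P: Prq => _ /forallP lr _ /forallP lq; apply/forallP => l.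
have [->|lj] := eqVneq l j; last by rewrite delete_exchange1.
have /cards2P[a [b [ab Gj]]] : #|G j| == 2%N by move/forallP: lG.
have [u Gxu] : exists u, G j = [set x; lift x u].
  move: xj; rewrite Gj !inE => /orP[] /eqP xE; move: ab; rewrite -xE.
    by move=> /unlift_some[u -> _]; exists u.
  by rewrite eq_sym => /unlift_some[u -> _]; exists u; rewrite setUC.
have uj k : (lift x k \in G j) = (k == u).
  rewrite Gxu !inE eq_sym (negPf (neq_lift _ _)).
  by rewrite (inj_eq (@lift_inj _ x)).
have yu : y != u by rewrite -uj.
have -> : delete G x r' j = [set u; q j].
  apply/setP => k; rewrite in_delete ?exchange_reconnections1 // uj ffunE eqxx.
  by rewrite !inE (inj_eq (@lift_inj _ x)) [q j == k]eq_sym.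
rewrite cards2; have [uq|//] := eqVneq u (q j); have := lq j => /=.
have q'y : q' j = y.
  by apply/eqP; have := exchange_pivot; rewrite -uq eq_sym (negPf yu) => /esym/negbFE.
have [v uv _] := unlift_some yu.
have -> : delete (delete G x r) y q j = [set v].
  apply/setP => k; rewrite !in_delete // uj lift_exchange q'y -uq uv.
  rewrite !(inj_eq (@lift_inj _ _)) (negPf (neq_lift _ _)) !inE orbF.
  by rewrite [v == k]eq_sym orbb.
by rewrite cards1.
Qed.

Lemma exchange_admissible : admissible G x y (r', q').
Proof.
apply/and4P; split=> /=.
- exact: exchange_reconnections1.
- exact: exchange_loopless.
- exact: exchange_reconnections2.
- by rewrite delete2_exchange; case/and4P: Prq.
Qed.

Lemma exchangeK : exchange x y j (r', q') = (r, q).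
Proof.
congr pair; apply/ffunP => l; rewrite ffunE /=; case: eqP => [->|/eqP lj].
- by rewrite -lift_exchange.
- by rewrite ffunE (negPf lj).
- by rewrite ffunE eqxx liftK.
- by rewrite ffunE (negPf lj).
Qed.

Lemma exchange_valence (K : fieldType) :
  (-1) ^+ valence (delete G x r') y = - (-1) ^+ valence (delete G x r) y :> K.
Proof.
rewrite /valence !(cardsD1 j (edges_at _ y)) !inE.
rewrite in_delete_pivot_exchange in_delete_pivot exchange_pivot.
have -> : edges_at (delete G x r') y :\ j = edges_at (delete G x r) y :\ j.
  apply/setP => l; rewrite !inE; case: eqVneq => //= lj.
  by rewrite delete_exchange1.
by rewrite !exprD signrN mulNr.
Qed.

End Exchange.

Lemma sum_delete2_eq0 (K : fieldType) i G x y j :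
  (2 : K) != 0 -> loopless G -> x \in G j -> lift x y \notin G j ->
  \sum_(p | admissible G x y p) (-1) ^+ valence (delete G x p.1) y *:
     gvec K i (delete (delete G x p.1) y p.2) = 0.
Proof.
move=> two_neq0 lG xj yj.
apply: (sum_sign_reversing (h := exchange x y j)) => // -[r q] Prq.
- exact: exchange_admissible.
- exact: exchangeK Prq.
- by rewrite delete2_exchange // exchange_valence // scaleNr.
Qed.

End DeleteTwice.

(** * Multiple edges *)

Lemma edge_avoiding n e (G : edge_family n e) x z :
  loopless G -> injective G -> (1 < valence G x)%N -> z != x ->
  exists2 j, x \in G j & z \notin G j.
Proof.
move=> /forallP lG G_inj /card_gt1P[j [l [jx lx jl]]] zx.
have edgeE k : k \in edges_at G x -> z \in G k -> G k = [set x; z].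
  rewrite inE => xk zk; apply/esym/eqP; rewrite eqEcard (eqP (lG k)) cards2.
  rewrite eq_sym zx andbT.
  by apply/subsetP => a; rewrite !inE => /orP[] /eqP ->.
have [zj|zj] := boolP (z \in G j); last by exists j => //; rewrite inE in jx.
have [zl|zl] := boolP (z \in G l); last by exists l => //; rewrite inE in lx.
by case/eqP: jl; apply: G_inj; rewrite (edgeE j jx zj) (edgeE l lx zl).
Qed.

Lemma carries_tperm n e (G : edge_family n e) j l :
  G j = G l -> carries 1 (tperm j l) G G.
Proof.
move=> Gjl; apply/forallP => k.
have -> : [set (1%g : 'S_n) a | a in G k] = G k.
  by rewrite -[RHS]imset_id; apply: eq_imset => a; rewrite perm1.
by case: tpermP => [->|->|_ _]; rewrite ?Gjl.
Qed.

Lemma multiple_edge_relation (K : fieldType) i n e (G : graph i n e) :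
  (2 : K) != 0 -> ~~ injectiveb (graph_edges G) ->
  gvec K i G \in relations K i n e.
Proof.
move=> two_neq0 /injectivePn[j [l lj Gjl]].
have := relation_mem K (carries_tperm Gjl).
rewrite odd_tperm lj expr1 scaleN1r opprK -mulr2n -scaler_nat.
by move=> /(memvZ 2^-1); rewrite scalerA mulVf ?scale1r.
Qed.

(** * The square of the vertex deletion *)

Lemma Dhom_Dgraph (K : fieldType) i n e (G : graph i n.+2 e) :
  Dhom (Dgraph K i G) = \sum_(x : 'I_n.+2) \sum_(y : 'I_n.+1)
    (-1) ^+ valence G x *: \sum_(p | admissible G x y p)
      (-1) ^+ valence (delete G x p.1) y *:
        gvec K i (delete (delete G x p.1) y p.2).
Proof.
rewrite /Dgraph linear_sum; apply: eq_bigr => x _.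
rewrite linearZ linear_sum -scaler_sumr /=; congr (_ *: _).
under eq_bigr => r /andP[_ lr].
  rewrite (Dhom_gvec K (Graph (delete_graphP lr))) /Dgraph /=.
  under eq_bigr => y _ do rewrite scaler_sumr.
  over.
rewrite exchange_big /=; apply: eq_bigr => y _.
rewrite pair_big_dep /=; apply: eq_bigl => -[r q] /=.
by rewrite /admissible /= !andbA.
Qed.

Lemma Dhom_Dgraph_relation (K : fieldType) n e (G : graph 2 n.+2 e) :
  (2 : K) != 0 -> Dhom (Dgraph K 2 G) \in relations K 2 n e.
Proof.
move=> two_neq0.
have [/injectiveP G_inj|multG] := boolP (injectiveb (graph_edges G)); last first.
  by rewrite -Dhom_gvec !Dhom_relations ?multiple_edge_relation.
rewrite Dhom_Dgraph big1 ?mem0v // => x _; rewrite big1 // => y _.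
have lG := graph_loopless G.
have vx : (1 < valence G x)%N by have /forallP := graph_min_valence G.
have yx : lift x y != x by rewrite eq_sym neq_lift.
have [j xj yj] := edge_avoiding lG G_inj vx yx.
by rewrite (sum_delete2_eq0 _ two_neq0 lG xj yj) scaler0.
Qed.

Theorem proposition3p1 (K : fieldType) (charK0 : [pchar K] =i pred0)
  (x : fGC K 2) : D (D x) = 0.
Proof.
have two_neq0 : (2 : K) != 0.
  by have := charK0 2; rewrite !inE /= => ->.
rewrite -[x]reprK !D_pi -[RHS](linear0 \pi_(fGC K 2)%qT).
apply/fGC_eqP; rewrite subr0; apply/fgc_relP => n e.
rewrite !component_Dsum {2}/Dhom linear_sum; apply: rpred_sum => G _.
by rewrite linearZ memvZ // Dhom_Dgraph_relation.
Qed.
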